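(* The Assouad, lower, and modified lower spectra are bi-Lipschitz invariant. That is, if $X$ and $Y$ are doubling metric spaces, $S:X\to Y$ is a bi-Lipschitz map (there is $K\geq1$ with $K^{-1}d_X(x,y)\leq d_Y(S(x),S(y))\leq K d_X(x,y)$ for all $x,y\in X$) and $\emptyset\neq F\subseteq X$, then for every $\theta\in(0,1)$ \[ \dim_{\mathrm A}^{\theta}S(F)=\dim_{\mathrm A}^{\theta}F,\qquad \dim_{\mathrm L}^{\theta}S(F)=\dim_{\mathrm L}^{\theta}F,\qquad \dim_{\mathrm{ML}}^{\theta}S(F)=\dim_{\mathrm{ML}}^{\theta}F. \]
   Context: A metric space is doubling if there is a uniform constant $C$ such that any ball may be covered by fewer than $C$ balls of half the radius. For a subset $E$ of a metric space and $r>0$, $N(E,r)$ denotes the minimal number of balls of radius $r$ required to cover $E$, and $B(x,R)$ is the ball of radius $R$ centred at $x$. For $\theta\in(0,1)$, the Assouad spectrum of $F$ at $\theta$ is \[ \dim_{\mathrm A}^{\theta} F = \inf\Big\{\alpha : \exists C>0,\ \exists \rho>0,\ \forall\, 0<R\leq\rho,\ \forall x\in F,\ N(B(x,R)\cap F,R^{1/\theta})\leq C \big(R/R^{1/\theta}\big)^{\alpha}\Big\}, \] the lower spectrum is \[ \dim_{\mathrm L}^{\theta} F = \sup\Big\{\alpha : \exists C>0,\ \exists \rho>0,\ \forall\, 0<R\leq\rho,\ \forall x\in F,\ N(B(x,R)\cap F,R^{1/\theta})\geq C \big(R/R^{1/\theta}\big)^{\alpha}\Big\}, \] and the modified lower spectrum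 is $\dim_{\mathrm{ML}}^{\theta}F=\sup\{\dim_{\mathrm L}^{\theta}E : \emptyset\neq E\subseteq F\}$. *)

(* Defs.v *)
From mathcomp Require Import all_boot all_order all_algebra.
From mathcomp Require Import all_classical all_reals all_analysis.

Set Implicit Arguments.
Unset Strict Implicit.
Unset Printing Implicit Defensive.

Import Order.TTheory GRing.Theory Num.Theory.

Local Open Scope classical_set_scope.
Local Open Scope ring_scope.

(* [ball] is the library's open ball; the centres of the covering balls range
   over the whole ambient space. *)
Definition coverable {R : realType} {X : metricType R}
    (E : set X) (r : R) (n : nat) : Prop :=
  exists c : 'I_n -> X, E `<=` \bigcup_i ball (c i) r.

(* The infimum is attained when E has a finite cover, and is +oo otherwise. *)
Definition covering_number {R : realType} {X : metricType R}
    (E : set X) (r : R) : \bar R :=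
  ereal_inf [set (n%:R : R)%:E | n in [set n | coverable E r n]].

Definition doubling {R : realType} (X : metricType R) : Prop :=
  exists C : R, forall (x : X) (r : R), 0 < r ->
    (covering_number (ball x r) (r / 2) < C%:E)%E.

Definition bilipschitz {R : realType} {X Y : metricType R} (S : X -> Y) : Prop :=
  exists2 K : R, 1 <= K &
    forall x y : X,
      K^-1 * mdist x y <= mdist (S x) (S y) /\
      mdist (S x) (S y) <= K * mdist x y.

Definition assouad_spectrum {R : realType} {X : metricType R}
    (theta : R) (F : set X) : \bar R :=
  ereal_inf [set alpha%:E | alpha in [set alpha : R |
    exists C rho : R, [/\ 0 < C, 0 < rho &
      forall r : R, 0 < r -> r <= rho -> forall x : X, F x ->
        (covering_number (ball x r `&` F) (r `^ (1 / theta))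
          <= (C * (r / r `^ (1 / theta)) `^ alpha)%:E)%E]]].

Definition lower_spectrum {R : realType} {X : metricType R}
    (theta : R) (F : set X) : \bar R :=
  ereal_sup [set alpha%:E | alpha in [set alpha : R |
    exists C rho : R, [/\ 0 < C, 0 < rho &
      forall r : R, 0 < r -> r <= rho -> forall x : X, F x ->
        ((C * (r / r `^ (1 / theta)) `^ alpha)%:E
          <= covering_number (ball x r `&` F) (r `^ (1 / theta)))%E]]].

Definition modified_lower_spectrum {R : realType} {X : metricType R}
    (theta : R) (F : set X) : \bar R :=
  ereal_sup [set lower_spectrum theta E |
    E in [set E : set X | E !=set0 /\ E `<=` F]].

(* Main.v *)
Require Import Defs.
From mathcomp Require Import all_boot all_order all_algebra.
From mathcomp Require Import all_classical all_reals all_analysis.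

(** The idea is that a bi-Lipschitz map distorts every scale by at most a
    constant factor, and that in a doubling space a constant factor in the
    radius costs only a constant factor in covering numbers.

    Write [p] for [1 / theta].  If a [K]-Lipschitz map carries [A] onto [B], a
    cover of [A] by [n] balls of radius [r] gives a cover of [B] by [n] balls of
    radius [2 K r], and doubling refines each of these into a number of balls of
    radius [s] that depends only on a bound for [r / s]
    ([covering_number_lipschitz]).  Apply this to the pieces
    [ball x (K r) `&` F], at scale [(K r) `^ p], and [ball (S x) r `&` S F], at
    scale [r `^ p]: the ratio of the two scales is the constant [K `^ p], and
    the gauge [R / R `^ p] also changes only by a constant factor between
    [R = r] and [R = K r] ([gauge_scale]).  Thus every exponent admissible for
    [F] is admissible for [S F], with other constants [C] and [rho].

    The converse transfers run along the inverse of [S], which is defined only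
    on the image.  Everything is therefore proved for bi-Lipschitz
    correspondences, relations between two sets that distort distances by at
    most [K] both ways; this notion is symmetric, so each spectrum needs one
    inequality only ([assouad_spectrum_corr], [lower_spectrum_corr]).  It also
    restricts to subsets, which gives the modified lower spectrum
    ([modified_lower_spectrum_corr]). *)

Set Implicit Arguments.
Unset Strict Implicit.
Unset Printing Implicit Defensive.

Import Order.TTheory GRing.Theory Num.Theory.

Local Open Scope classical_set_scope.
Local Open Scope ring_scope.

(** * Covers listed by their centres *)

(** Unions of covers become concatenations, and a bound on the size of a
    sequence is met without padding by spurious centres, which an empty space
    could not supply. *)
Definition covers {R : realType} {X : metricType R} (E : set X) (r : R)
    (s : seq X) : Prop :=
  forall x, E x -> exists2 c, c \in s & ball c r x.

Lemma covers_coverable (R : realType) (X : metricType R) (E : set X) (r : R)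
    (s : seq X) :
  covers E r s -> coverable E r (size s).
Proof.
move=> Es; exists (tnth (in_tuple s)) => x /Es[c cs xc].
by have /tnthP[i ci] : c \in in_tuple s := cs; exists i; rewrite -?ci.
Qed.

Lemma coverable_covers (R : realType) (X : metricType R) (E : set X) (r : R)
    (n : nat) :
  coverable E r n -> exists2 s, size s = n & covers E r s.
Proof.
move=> [c Ec]; exists [seq c i | i <- enum 'I_n].
  by rewrite size_map size_enum_ord.
by move=> x /Ec[i _ xi]; exists (c i) => //; rewrite map_f ?mem_enum.
Qed.

Lemma covering_number_le_size (R : realType) (X : metricType R) (E : set X)
    (r : R) (s : seq X) :
  covers E r s -> (covering_number E r <= ((size s)%:R : R)%:E)%E.
Proof.
move=> /covers_coverable Es; apply: ge_ereal_inf.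
by exists ((size s)%:R%:E) => //; exists (size s).
Qed.

Lemma covers_of_covering_number_lt (R : realType) (X : metricType R)
    (E : set X) (r v : R) :
  (covering_number E r < v%:E)%E ->
  exists2 s, (size s)%:R < v & covers E r s.
Proof.
move=> /ereal_inf_lt[_ [n /coverable_covers[s sn Es] <-]].
by rewrite lte_fin -sn => sv; exists s.
Qed.

Lemma covers_bigcup (R : realType) (Y : metricType R) (I : eqType)
    (l : seq I) (P : I -> set Y) (r : R) (M : nat) :
  (forall i, exists2 s, (size s <= M)%N & covers (P i) r s) ->
  exists2 s, (size s <= M * size l)%N &
    covers [set y | exists2 i, i \in l & P i y] r s.
Proof.
move=> PM; elim: l => [|i l [s sl ls]].
  by exists [::]; rewrite //= => y [].
have [t tM it] := PM i; exists (t ++ s).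
  by rewrite size_cat /= mulnS leq_add.
move=> y /= [j]; rewrite inE => /predU1P[->|jl] Py.
  by have [c ct yc] := it _ Py; exists c; rewrite // mem_cat ct.
have [|c cs yc] := ls y; first by exists j.
by exists c; rewrite // mem_cat cs orbT.
Qed.

(** * Comparing covering numbers in a doubling space *)

Lemma doubling_iter (R : realType) (X : metricType R) :
  doubling X ->
  exists D : nat, forall (k : nat) (x : X) (r : R), 0 < r ->
    exists2 s, (size s <= D ^ k)%N & covers (ball x r) (r / 2 ^+ k) s.
Proof.
move=> [C dbl]; exists (Num.trunc C).+1 => k x r.
elim: k x r => [|k IHk] x r r0.
  by exists [:: x] => // y xy; exists x; rewrite ?inE ?expr0 ?divr1.
have [s sC xs] := covers_of_covering_number_lt (dbl x r r0).
have sD : (size s <= (Num.trunc C).+1)%N.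
  by rewrite -(ler_nat R) ltW// (lt_trans sC)// truncnS_gt.
have r20 : 0 < r / 2 by rewrite divr_gt0.
have [t tD st] := covers_bigcup s (fun c => IHk c (r / 2) r20).
exists t.
  by rewrite (leq_trans tD)// expnSr leq_mul2l sD orbT.
move=> y /xs[c cs yc]; rewrite exprS invfM mulrA.
by apply: st; exists c.
Qed.

(** The centres of a cover of [A] need not lie in [A], and the relation need
    not reach them; each ball that matters is recentred at a point of [B]
    related to it, hence the factor 2. *)
Lemma covering_number_lipschitz (R : realType) (X Y : metricType R) (K L : R) :
  doubling Y -> 0 < K ->
  exists2 M : R, 0 < M &
    forall (T : X -> Y -> Prop) (A : set X) (B : set Y) (r s : R),
      0 < s -> r <= L * s ->
      (forall y, B y -> exists2 x, A x & T x y) ->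
      (forall x x' y y', T x y -> T x' y' ->
        mdist y y' <= K * mdist x x') ->
      (covering_number B s <= M%:E * covering_number A r)%E.
Proof.
move=> /doubling_iter[D dbl] K0.
have [k kL] : exists k, 2 * K * L < 2 ^+ k.
  by exists (Num.bound (2 * K * L)); apply: upper_nthrootP.
(* The successor only makes the constant positive. *)
exists (D ^ k).+1%:R => // T A B r s s0 rs BA Tlip.
rewrite -lee_pdivrMl//; apply: le_ereal_inf_tmp => _ [n /= + <-].
move=> /coverable_covers[l <- Al].
rewrite lee_pdivrMl// -EFinM -natrM.
pose P c := [set y | B y /\ exists2 x, T x y & ball c r x].
have Pcov c : exists2 t, (size t <= (D ^ k).+1)%N & covers (P c) s t.
  have [[y [By [x Txy cx]]]|P0] := pselect (P c !=set0); last first.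
    by exists [::] => // y Py; case: P0; exists y.
  have sk0 : 0 < s * 2 ^+ k by rewrite mulr_gt0 ?exprn_gt0.
  have [t tD yt] := dbl k y (s * 2 ^+ k) sk0.
  exists t; first exact: leqW.
  move=> y' [_ [x' Tx' cx']].
  have -> : s = s * 2 ^+ k / 2 ^+ k by rewrite mulfK// expf_neq0.
  apply: yt; rewrite ballEmdist/=.
  have : ball x (r + r) x' by exact: ball_triangle (ball_sym cx) cx'.
  rewrite ballEmdist/= => xx'.
  apply: (le_lt_trans (Tlip _ _ _ _ Txy Tx')).
  apply: (@lt_trans _ _ (K * (r + r))); first by rewrite ltr_pM2l.
  apply: (@le_lt_trans _ _ (2 * K * L * s)); last first.
    by rewrite [ltRHS]mulrC ltr_pM2r.
  by rewrite -mulr2n mulrnAr -mulr_natl -!mulrA !ler_pM2l.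
have [t tM lt] := covers_bigcup l Pcov.
apply: le_trans (_ : (size t)%:R%:E <= _)%E; last by rewrite lee_fin ler_nat.
apply: covering_number_le_size => y By; apply: lt.
have [x Ax Txy] := BA _ By; have [c cl cx] := Al _ Ax.
by exists c => //; split=> //; exists x.
Qed.

(** * Bi-Lipschitz correspondences *)

(** A relation replaces the map so that [F] and [G] play the same role and
    no inverse function has to be chosen. *)
Definition bilip_corr {R : realType} {X Y : metricType R} (K : R)
    (T : X -> Y -> Prop) (F : set X) (G : set Y) : Prop :=
  [/\ forall x, F x -> exists2 y, G y & T x y,
      forall y, G y -> exists2 x, F x & T x y &
      forall x x' y y', T x y -> T x' y' ->
        mdist y y' <= K * mdist x x' /\ mdist x x' <= K * mdist y y'].

Lemma bilip_corr_sym (R : realType) (X Y : metricType R) (K : R)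
    (T : X -> Y -> Prop) (F : set X) (G : set Y) :
  bilip_corr K T F G -> bilip_corr K (fun y x => T x y) G F.
Proof.
by move=> [FG GF TK]; split=> // y y' x x' Txy Txy';
  have [] := TK _ _ _ _ Txy Txy'.
Qed.

Lemma bilip_corr_sub (R : realType) (X Y : metricType R) (K : R)
    (T : X -> Y -> Prop) (F E : set X) (G : set Y) :
  bilip_corr K T F G -> E `<=` F ->
  bilip_corr K T E [set y | G y /\ exists2 x, E x & T x y].
Proof.
move=> [FG GF TK] EF; split=> //; last by move=> y [_ [x Ex Txy]]; exists x.
move=> x Ex; have [y Gy Txy] := FG _ (EF _ Ex).
by exists y => //; split=> //; exists x.
Qed.

Lemma bilip_corr_image (R : realType) (X Y : metricType R) (K : R)
    (S : X -> Y) (F : set X) :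
  0 < K ->
  (forall x y, K^-1 * mdist x y <= mdist (S x) (S y) /\
     mdist (S x) (S y) <= K * mdist x y) ->
  bilip_corr K (fun x y => S x = y) F (S @` F).
Proof.
move=> K0 SK; split.
- by move=> x Fx; exists (S x) => //; exists x.
- by move=> y [x Fx Sxy]; exists x.
- move=> x x' _ _ <- <-; have [Kl Kr] := SK x x'; split=> //.
  by rewrite -ler_pdivrMl.
Qed.

(** * Transfer of the spectra *)

(** For [p = 1 / theta], [r / r `^ p] is the ratio of scales whose powers
    gauge the covering numbers; it is homogeneous in [r]. *)
Lemma gauge_scale (R : realType) (p alpha k r : R) : 0 < k -> 0 < r ->
  (k * r / (k * r) `^ p) `^ alpha =
  (k / k `^ p) `^ alpha * (r / r `^ p) `^ alpha.
Proof.
move=> k0 r0.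
have ratio_ge0 a : 0 < a -> 0 <= a / a `^ p.
  by move=> a0; rewrite divr_ge0 ?powR_ge0// ltW.
rewrite (powRM _ (ltW k0) (ltW r0)) invfM mulrACA.
by rewrite (powRM _ (ratio_ge0 _ k0) (ratio_ge0 _ r0)).
Qed.

Lemma gauge_gt0 (R : realType) (p alpha k : R) : 0 < k ->
  0 < (k / k `^ p) `^ alpha.
Proof. by move=> k0; rewrite powR_gt0 ?divr_gt0 ?powR_gt0. Qed.

(** A ball of radius [r] in [G] corresponds to a part of a ball of radius
    [K r] in [F], so an upper bound for the latter is inherited. *)
Lemma assouad_spectrum_corr (R : realType) (X Y : metricType R) (K theta : R)
    (T : X -> Y -> Prop) (F : set X) (G : set Y) :
  doubling Y -> 0 < K -> bilip_corr K T F G ->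
  (assouad_spectrum theta G <= assouad_spectrum theta F)%E.
Proof.
move=> dY K0 [FG GF TK]; apply: ereal_inf_le_tmp.
apply: image_subset => alpha [C [rho [C0 rho0 CF]]].
set p := 1 / theta in CF *.
have [M M0 MT] := covering_number_lipschitz X (K `^ p) dY K0.
exists (M * (C * (K / K `^ p) `^ alpha)), (K^-1 * rho).
split; [by rewrite !mulr_gt0 ?gauge_gt0|by rewrite mulr_gt0 ?invr_gt0|].
move=> r r0; rewrite ler_pdivlMl// => Kr y Gy.
have [x Fx Txy] := GF _ Gy.
have Kr0 : 0 < K * r by rewrite mulr_gt0.
have NK : (covering_number (ball y r `&` G) (r `^ p) <=
    M%:E * covering_number (ball x (K * r) `&` F) ((K * r) `^ p))%E.
  apply: (MT T); first exact: powR_gt0.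
  - by rewrite powRM// ltW.
  - move=> y' [yy' Gy']; have [x' Fx' Tx'] := GF _ Gy'; exists x' => //.
    split=> //; move: yy'; rewrite !ballEmdist/= => yy'.
    have [_ xx'] := TK _ _ _ _ Txy Tx'.
    by rewrite (le_lt_trans xx')// ltr_pM2l.
  - by move=> a a' b b' Tab Ta'b'; have [] := TK _ _ _ _ Tab Ta'b'.
rewrite (le_trans NK)// -!mulrA -gauge_scale// [leRHS]EFinM lee_pmul2l//.
exact: CF.
Qed.

(** Here the comparison runs from [G] to [F]: a ball of radius [r / K] in [F]
    corresponds to a part of a ball of radius [r] in [G], and a lower bound for
    the former passes to the latter. *)
Lemma lower_spectrum_corr (R : realType) (X Y : metricType R) (K theta : R)
    (T : X -> Y -> Prop) (F : set X) (G : set Y) :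
  doubling X -> 0 < K -> bilip_corr K T F G ->
  (lower_spectrum theta F <= lower_spectrum theta G)%E.
Proof.
move=> dX K0 [FG GF TK]; apply: ereal_sup_le.
apply: image_subset => alpha [C [rho [C0 rho0 CF]]].
set p := 1 / theta in CF *.
have Ki0 : 0 < K^-1 by rewrite invr_gt0.
have [M M0 MT] := covering_number_lipschitz Y (K `^ p) dX K0.
exists (M^-1 * (C * (K^-1 / K^-1 `^ p) `^ alpha)), (K * rho).
split; [by rewrite !mulr_gt0 ?gauge_gt0 ?invr_gt0|by rewrite mulr_gt0|].
move=> r r0; rewrite -ler_pdivrMl// => Kr y Gy.
have [x Fx Txy] := GF _ Gy.
have Kr0 : 0 < K^-1 * r by rewrite mulr_gt0.
have NK : (covering_number (ball x (K^-1 * r) `&` F) ((K^-1 * r) `^ p) <=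
    M%:E * covering_number (ball y r `&` G) (r `^ p))%E.
  apply: (MT (fun y x => T x y)); first exact: powR_gt0.
  - by rewrite -powRM ?(ltW K0) ?(ltW Kr0)// mulVKf// gt_eqF.
  - move=> x' [xx' Fx']; have [y' Gy' Ty'] := FG _ Fx'; exists y' => //.
    split=> //; move: xx'; rewrite !ballEmdist/= ltr_pdivlMl// => xx'.
    have [yy' _] := TK _ _ _ _ Txy Ty'.
    exact: le_lt_trans yy' xx'.
  - by move=> a a' b b' Tba Tb'a'; have [] := TK _ _ _ _ Tba Tb'a'.
rewrite -!mulrA -gauge_scale// EFinM lee_pdivrMl//.
by apply: le_trans NK; exact: CF.
Qed.

Lemma modified_lower_spectrum_corr (R : realType) (X Y : metricType R)
    (K theta : R) (T : X -> Y -> Prop) (F : set X) (G : set Y) :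
  doubling X -> 0 < K -> bilip_corr K T F G ->
  (modified_lower_spectrum theta F <= modified_lower_spectrum theta G)%E.
Proof.
move=> dX K0 FG; apply: ge_ereal_sup => _ [E [[x Ex] EF] <-].
have EG := bilip_corr_sub FG EF.
apply: le_trans (lower_spectrum_corr theta dX K0 EG) _.
apply: ereal_sup_ubound; eexists; last by reflexivity.
split; last by move=> y [].
by have [/(_ _ Ex)[y Gy _] _ _] := EG; exists y.
Qed.

Theorem corollary4p9 (R : realType) (X Y : metricType R)
    (hX : doubling X) (hY : doubling Y)
    (S : X -> Y) (hS : bilipschitz S)
    (F : set X) (hF : F !=set0)
    (theta : R) (htheta0 : 0 < theta) (htheta1 : theta < 1) :
  [/\ assouad_spectrum theta (S @` F) = assouad_spectrum theta F,
      lower_spectrum theta (S @` F) = lower_spectrum theta F &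
      modified_lower_spectrum theta (S @` F) = modified_lower_spectrum theta F].
Proof.
have [K K1 SK] := hS.
have K0 : 0 < K := lt_le_trans ltr01 K1.
have FS := bilip_corr_image F K0 SK.
have SF := bilip_corr_sym FS.
split; apply/eqP; rewrite eq_le; apply/andP; split.
- exact: assouad_spectrum_corr hY K0 FS.
- exact: assouad_spectrum_corr hX K0 SF.
- exact: lower_spectrum_corr hY K0 SF.
- exact: lower_spectrum_corr hX K0 FS.
- exact: modified_lower_spectrum_corr hY K0 SF.
- exact: modified_lower_spectrum_corr hX K0 FS.
Qed.
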